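(* Let $k$ be a positive integer and let $D$ be a strongly connected digraph that contains no subdivision of the oriented cycle $C(k,1,1,1,1,1)$ as a subdigraph. Then $\chi(D)\le 7\cdot 24^2\cdot k$.
   Context: All graphs are simple. The chromatic number $\chi(D)$ of a digraph is the chromatic number of its underlying undirected graph. A block of an oriented path or cycle is a maximal directed subpath. $C(k_1,\dots,k_n)$ denotes the oriented cycle consisting of $n$ blocks of lengths $k_1,\dots,k_n$ in this cyclic order (consecutive blocks have opposite orientations). A subdivision of a digraph $H$ is a digraph obtained from $H$ by replacing each arc $(x,y)$ by a directed path from $x$ to $y$ of length at least $1$, the new paths being internally disjoint. *)

(* Defs.v *)
From mathcomp Require Import all_boot.

Set Implicit Arguments.
Unset Strict Implicit.
Unset Printing Implicit Defensive.

Record sgraph := SGraph {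
  svertex :> finType;
  edge : rel svertex;
  edge_sym : symmetric edge;
  edge_irrefl : irreflexive edge }.

(* Finite, without loops or parallel arcs; a pair of opposite arcs is
   allowed. *)
Record digraph := Digraph {
  vertex :> finType;
  darc : rel vertex;
  darc_irrefl : irreflexive darc }.

Definition proper_coloring (G : sgraph) (n : nat) (f : {ffun G -> 'I_n}) : bool :=
  [forall x, forall y, edge x y ==> (f x != f y)].

Definition colorable (G : sgraph) (n : nat) : bool :=
  [exists f : {ffun G -> 'I_n}, proper_coloring f].

Lemma colorable_ex (G : sgraph) : exists n, colorable G n.
Proof.
exists #|G|; apply/existsP; exists [ffun x => enum_rank x].
apply/forallP => x; apply/forallP => y; apply/implyP => exy.
rewrite !ffunE (inj_eq enum_rank_inj).
by apply: contraTneq exy => ->; rewrite edge_irrefl.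
Qed.

Definition chromatic_number (G : sgraph) : nat := ex_minn (colorable_ex G).

Section Underlying.
Variable D : digraph.
Let e : rel D := [rel x y : D | darc x y || darc y x].
Fact underlying_sym : symmetric e.
Proof. by move=> x y; rewrite /e /= orbC. Qed.
Fact underlying_irrefl : irreflexive e.
Proof. by move=> x; rewrite /e /= darc_irrefl. Qed.
Definition underlying : sgraph := SGraph underlying_sym underlying_irrefl.
End Underlying.

Definition chi (D : digraph) : nat := chromatic_number (underlying D).

Definition strongly_connected (D : digraph) : Prop :=
  forall x y : D, connect (@darc D) x y.

(* S is a subdigraph of D up to isomorphism. *)
Definition subdigraph (S D : digraph) : Prop :=
  exists f : S -> D, injective f /\ (forall x y, darc x y -> darc (f x) (f y)).

(* phi places the vertices of H in S, and the arc (x, y) of H is replaced by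
   the directed path phi x :: rcons (P x y) (phi y), so that P x y lists its
   internal vertices. The last two fields say that S has no vertices or arcs
   other than those of these paths and the images of the vertices of H. *)
Record subdivision_map (H S : digraph) (phi : H -> S) (P : H -> H -> seq S) :
    Prop := SubdivisionMap {
  sd_inj : injective phi;
  sd_path : forall x y, darc x y -> path (@darc S) (phi x) (rcons (P x y) (phi y));
  sd_uniq : forall x y, darc x y -> uniq (P x y);
  sd_internal : forall x y z, darc x y -> phi z \notin P x y;
  sd_disjoint : forall x y x' y', darc x y -> darc x' y' -> (x, y) != (x', y') ->
    ~~ has (mem (P x y)) (P x' y');
  sd_vertices : forall v : S,
    (exists z, v = phi z) \/ (exists x y, darc x y /\ v \in P x y);
  sd_arcs : forall u v : S, darc u v ->
    exists x y, darc x y /\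
      (u, v) \in zip (phi x :: P x y) (rcons (P x y) (phi y)) }.

Definition is_subdivision (H S : digraph) : Prop :=
  exists (phi : H -> S) (P : H -> H -> seq S), subdivision_map phi P.

Definition contains_subdivision (D H : digraph) : Prop :=
  exists S : digraph, is_subdivision H S /\ subdigraph S D.

(* C(k_1, ..., k_n), for n even and positive k_i: the vertices are
   0, ..., m - 1 with m = k_1 + ... + k_n, and the i-th edge, joining i and
   i + 1 mod m, lies in the block of index reshape_index ks i (counted from 0).
   It is oriented from i to i + 1 in blocks of even index and from i + 1 to i
   in blocks of odd index. The guard x != y only matters when m = 1. *)
Section OrientedCycle.
Variable ks : seq nat.
Let e : rel 'I_(sumn ks) := [rel x y : 'I_(sumn ks) | (x != y) &&
  ((~~ odd (reshape_index ks x) && (y == ordS x)) ||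
   (odd (reshape_index ks y) && (x == ordS y)))].
Fact oriented_cycle_irrefl : irreflexive e.
Proof. by move=> x; rewrite /e /= eqxx. Qed.
Definition oriented_cycle : digraph := Digraph oriented_cycle_irrefl.
End OrientedCycle.

(* Main.v *)
(** Take a spanning out-tree of D maximising the sum of the levels; then every
arc from x to y with lev y <= lev x has its head y above x in the tree. Colour
a vertex by its level modulo k and by a second colour that separates adjacent
vertices of the same residue. The arcs between vertices of one residue are of
three types: down to a descendant, up to an ancestor, and down between
incomparable vertices. If one type had more than 7|W| arcs inside a set W, some
nonempty subset of these arcs would have degrees at least 5 at every upper end
and at least 4 at every lower end; choosing an upper end x of maximal level,
the tree then closes a few of these arcs into a cycle with six blocks, one of
which follows the tree between two levels with the same residue and so has
length at least k. Hence each residue class is 42-degenerate, and 43 k colours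
suffice. *)

Require Import Defs.
From mathcomp Require Import all_boot zify.

Set Implicit Arguments.
Unset Strict Implicit.
Unset Printing Implicit Defensive.

Lemma zip_path (T : eqType) (e : rel T) x s y u v :
  path e x (rcons s y) -> (u, v) \in zip (x :: s) (rcons s y) -> e u v.
Proof.
elim: s x => [|z s IHs] x /=.
  by rewrite andbT inE => exy /eqP[-> ->].
case/andP=> exz hs; rewrite inE => /orP[/eqP[-> ->] //|]; exact: IHs.
Qed.

Lemma path_zip (T : eqType) x (s : seq T) y :
  path (fun u v => (u, v) \in zip (x :: s) (rcons s y)) x (rcons s y).
Proof.
elim: s x => [|z s IHs] x /=; first by rewrite mem_head.
rewrite mem_head /=; apply: sub_path (IHs z) => u v uv.
by rewrite inE uv orbT.
Qed.

Lemma map_zip (T U : Type) (f : T -> U) s t :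
  zip (map f s) (map f t) = [seq (f p.1, f p.2) | p <- zip s t].
Proof. by elim: s t => [|x s IHs] [|y t] //=; rewrite IHs. Qed.

(** * Six-block cycles *)

Lemma contains_subdivision_embedding (D H : digraph) (phi : H -> D)
    (P : H -> H -> seq D) :
  injective phi ->
  (forall x y, darc x y -> path (@darc D) (phi x) (rcons (P x y) (phi y))) ->
  (forall x y, darc x y -> uniq (P x y)) ->
  (forall x y z, darc x y -> phi z \notin P x y) ->
  (forall x y x' y', darc x y -> darc x' y' -> (x, y) != (x', y') ->
    ~~ has (mem (P x y)) (P x' y')) ->
  contains_subdivision D H.
Proof.
move=> phi_inj P_path P_uniq P_int P_disj.
pose inS v := [exists z, v == phi z] ||
  [exists x, exists y, darc x y && (v \in P x y)].
pose e0 : rel D := fun u v => [exists x, exists y, darc x y &&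
  ((u, v) \in zip (phi x :: P x y) (rcons (P x y) (phi y)))].
have e0_darc u v : e0 u v -> darc u v.
  by case/existsP=> x /existsP[y /andP[xy]]; apply: zip_path; apply: P_path.
pose VS : finType := {v : D | inS v}.
have eS_irr : irreflexive (relpre val e0 : rel VS).
  move=> u /=; apply/negbTE/negP => /e0_darc; by rewrite darc_irrefl.
pose S := Digraph eS_irr.
have phiS z : inS (phi z) by apply/orP; left; apply/existsP; exists z.
have PS x y : darc x y -> all inS (P x y).
  move=> xy; apply/allP => v vP; apply/orP; right.
  by apply/existsP; exists x; apply/existsP; exists y; rewrite xy.
pose phi' z : S := exist _ (phi z) (phiS z).
pose P' x y : seq S := pmap insub (P x y).
have valP' x y : darc x y -> map val (P' x y) = P x y.
  move=> xy; rewrite /P' pmap_filter; last by move=> v; rewrite insubK.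
  apply/all_filterP/allP => v vP; rewrite isSome_insub.
  exact: (allP (PS _ _ xy)).
have mem_P' x y (v : S) : darc x y -> (v \in P' x y) = (val v \in P x y).
  by move=> xy; rewrite -valP' // mem_map //; apply: val_inj.
exists S; split; last by exists val; split=> [|x y /e0_darc]; [apply: val_inj|].
exists phi', P'; split.
- by move=> x y [] /phi_inj.
- move=> x y xy; rewrite -path_map map_rcons valP' //=.
  apply: sub_path (path_zip _ _ _) => u v uv.
  by apply/existsP; exists x; apply/existsP; exists y; rewrite xy.
- by move=> x y xy; rewrite -(map_inj_uniq val_inj) valP' // P_uniq.
- by move=> x y z xy; rewrite mem_P' // P_int.
- move=> x y x' y' xy xy' ne; apply/hasPn => v; rewrite mem_P' //= mem_P' //.
  by apply: (hasPn (P_disj _ _ _ _ xy xy' ne)).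
- move=> [v vS]; have /orP[/existsP[z /eqP vz]|] := vS.
    by left; exists z; apply: val_inj.
  case/existsP=> x /existsP[y /andP[xy vP]].
  by right; exists x, y; rewrite mem_P'.
- move=> u v /existsP[x /existsP[y /andP[xy uv]]]; exists x, y; split=> //.
  rewrite -(mem_map (f := fun p : S * S => (val p.1, val p.2))).
    by rewrite -map_zip map_rcons /= valP'.
  by move=> [a b] [c d] [/val_inj-> /val_inj->].
Qed.
Lemma reshape_index_oriented6 k i : i < k + 5 ->
  reshape_index [:: k; 1; 1; 1; 1; 1] i = i.+1 - k.
Proof.
rewrite /reshape_index /= => lti.
have: i.+1 - k <= 5 by lia.
by move: (i.+1 - k) => [|[|[|[|[|[|]]]]]].
Qed.

Lemma darc_oriented6 k (x y : oriented_cycle [:: k.+1; 1; 1; 1; 1; 1]) :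
  darc x y ->
  [|| (x <= k) && (y == x.+1 :> nat),
      (x == k + 2 :> nat) && (y == k + 1 :> nat),
      (x == k + 2 :> nat) && (y == k + 3 :> nat),
      (x == k + 4 :> nat) && (y == k + 3 :> nat),
      (x == k + 4 :> nat) && (y == k + 5 :> nat) |
      (x == 0 :> nat) && (y == k + 5 :> nat)].
Proof.
have lt6 (z : oriented_cycle [:: k.+1; 1; 1; 1; 1; 1]) : z < k.+1 + 5.
  by rewrite -[k.+1 + 5]/(sumn [:: k.+1; 1; 1; 1; 1; 1]) ltn_ord.
have ordS_val (z : oriented_cycle [:: k.+1; 1; 1; 1; 1; 1]) :
    ordS z = (if nat_of_ord z == k.+4.+1 then 0 else z.+1) :> nat.
  have := lt6 z; rewrite [LHS]/=; set m := (X in _ %% X).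
  have -> : m = k.+4.+2 by rewrite /m; lia.
  case: eqP => [->|ne lt]; last first.
    by rewrite modn_small //; move: (nat_of_ord z) ne lt => n; lia.
  by rewrite modnn.
have ordS_eq (u v : oriented_cycle [:: k.+1; 1; 1; 1; 1; 1]) :
    (u == ordS v) = (nat_of_ord u == if nat_of_ord v == k.+4.+1 then 0 else v.+1).
  by rewrite -ordS_val.
have lx := lt6 x; have ly := lt6 y.
case/andP=> _; rewrite !reshape_index_oriented6 //.
rewrite !ordS_eq.
move: (nat_of_ord x) (nat_of_ord y) lx ly => m n lm ln h.
have hx : m.+1 - k.+1 <= 5 by lia.
have hy : n.+1 - k.+1 <= 5 by lia.
have hx1 : (m.+1 - k.+1 = 0 -> m <= k) by lia.
have hx2 : (m.+1 - k.+1 > 0 -> m = k + (m.+1 - k.+1)) by lia.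
have hy2 : (n.+1 - k.+1 > 0 -> n = k + (n.+1 - k.+1)) by lia.
case/orP: h; case/andP.
  move: (m.+1 - k.+1) hx hx1 hx2 => [|[|[|[|[|[|?]]]]]] //= _.
  - by move=> /(_ erefl) ? _ _ /eqP; case: ifP; lia.
  - by move=> _ /(_ isT) ? _ /eqP; case: ifP; lia.
  - by move=> _ /(_ isT) ? _ /eqP; case: ifP; lia.
move: (n.+1 - k.+1) hy hy2 => [|[|[|[|[|[|?]]]]]] //= _ /(_ isT) ? _ /eqP; case: ifP; lia.
Qed.
Lemma perm_cat_drop (T : eqType) (x : T) a n p q :
  perm_eq ((x :: a) ++ p ++ q) ((x :: take n p ++ a) ++ drop n p ++ q).
Proof. by rewrite -{1}(cat_take_drop n p) /= perm_cons -!catA perm_catCA. Qed.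

Lemma uniq_flatten_all (T : eqType) (ss : seq (seq T)) :
  uniq (flatten ss) -> all uniq ss.
Proof. by elim: ss => //= s ss IHss; rewrite cat_uniq => /and3P[-> _ /IHss]. Qed.

Lemma uniq_flatten_nth (T : eqType) (ss : seq (seq T)) i j v :
  uniq (flatten ss) -> v \in nth [::] ss i -> v \in nth [::] ss j -> i = j.
Proof.
elim: ss i j => [|s ss IHss] [|i] [|j] //=; rewrite cat_uniq => /and3P[_ hs uss].
- move=> vs vj; case/negP: hs; apply/hasP; exists v => //.
  by apply/flattenP; exists (nth [::] ss j) => //; apply: mem_nth;
    case: leqP vj => // le; rewrite nth_default.
- move=> vi vs; case/negP: hs; apply/hasP; exists v => //.
  by apply/flattenP; exists (nth [::] ss i) => //; apply: mem_nth;
    case: leqP vi => // le; rewrite nth_default.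
- by move=> vi vj; congr _.+1; apply: IHss vi vj.
Qed.

Section SixBlocks.
Variables (D : digraph) (k : nat).
Local Notation dpath := (path (@darc D)).

Lemma contains_six_blocks_first s0 t0 s1 t1 s2 t2 p0 p1 p2 p3 p4 p5 : 0 < k ->
  dpath s0 (rcons p0 t0) -> dpath s1 (rcons p1 t0) ->
  dpath s1 (rcons p2 t1) -> dpath s2 (rcons p3 t1) ->
  dpath s2 (rcons p4 t2) -> dpath s0 (rcons p5 t2) ->
  uniq (flatten [:: [:: s0; t0; s1; t1; s2; t2]; p0; p1; p2; p3; p4; p5]) ->
  k <= (size p0).+1 ->
  contains_subdivision D (oriented_cycle [:: k; 1; 1; 1; 1; 1]).
Proof.
case: k => // n _ d0 d1 d2 d3 d4 d5 uL; rewrite ltnS => np0.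
pose L := s0 :: take n p0 ++ [:: t0; s1; t1; s2; t2].
pose ps := [:: drop n p0; p1; p2; p3; p4; p5].
have uLps : uniq (flatten (L :: ps)).
  have -> : flatten (L :: ps) =
      (s0 :: take n p0 ++ [:: t0; s1; t1; s2; t2]) ++ drop n p0 ++ flatten (behead ps) by [].
  rewrite -(perm_uniq (perm_cat_drop _ _ _ _ _)); exact: uL.
have szt : size (take n p0) = n by rewrite size_takel.
have szL : size L = n.+1 + 5 by rewrite /= size_cat szt.
pose H := oriented_cycle [:: n.+1; 1; 1; 1; 1; 1].
have ltL (z : H) : z < size L.
  by rewrite szL -[n.+1 + 5]/(sumn [:: n.+1; 1; 1; 1; 1; 1]) ltn_ord.
pose phi (x : H) := nth s0 L x.
pose b (x y : nat) :=
  if (x == n + 0) && (y == n + 1) then 0 else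
  if (x == n + 2) && (y == n + 1) then 1 else
  if (x == n + 2) && (y == n + 3) then 2 else
  if (x == n + 4) && (y == n + 3) then 3 else
  if (x == n + 4) && (y == n + 5) then 4 else
  if (x == 0) && (y == n + 5) then 5 else 6.
have b0 : b (n + 0) (n + 1) = 0 by rewrite /b !eqn_add2l.
have b1 : b (n + 2) (n + 1) = 1 by rewrite /b !eqn_add2l.
have b2 : b (n + 2) (n + 3) = 2 by rewrite /b !eqn_add2l.
have b3 : b (n + 4) (n + 3) = 3 by rewrite /b !eqn_add2l.
have b4 : b (n + 4) (n + 5) = 4 by rewrite /b !eqn_add2l.
have b5 : b 0 (n + 5) = 5 by rewrite /b !eqn_add2l !andbF [n + 4]addnC.
have b_inv p q : b p q != 6 -> (p, q) = nth (0, 0) [:: (n + 0, n + 1); (n + 2, n + 1);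
    (n + 2, n + 3); (n + 4, n + 3); (n + 4, n + 5); (0, n + 5)] (b p q).
  rewrite /b; do 6 (case: ifP => [/andP[/eqP-> /eqP->] //|_]).
  by [].
pose P (x y : H) := nth [::] ps (b x y).
have phiE x i : nat_of_ord x = n + i ->
  phi x = nth s0 (last s0 (take n p0) :: [:: t0; s1; t1; s2; t2]) i.
  move=> xE; rewrite /phi /L xE.
  case: i {xE} => [|i].
    rewrite addn0 -cat_cons nth_cat /= szt ltnSn.
    by rewrite (last_nth s0) szt.
  rewrite -cat_cons nth_cat /= szt; have -> : n + i.+1 < n.+1 = false by lia.
  by have -> : n + i.+1 - n.+1 = i by lia.
have uLs := uniq_flatten_all uLps.
have uL1 : uniq L.
  by case/andP: uLs.
apply: (@contains_subdivision_embedding D H phi P).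
- move=> x y /eqP; rewrite nth_uniq // => /eqP; exact: val_inj.
- move=> x y /darc_oriented6 h.
  move: h; rewrite /P => /or4P[||| /or3P[||]] => [|||||] /andP[+ /eqP yE] => [xle|||||].
  - have [xn|nx] := ltnP x n.
      have -> : b x y = 6.
        rewrite yE /b; move: (nat_of_ord x) xn => p pn.
        have F i : (p == n + i) = false by rewrite ltn_eqF // ltn_addr.
        by rewrite !F /= -(addn1 4) addnA addn1 eqSS F andbF.
      rewrite /= andbT /phi yE /L -cat_cons nth_cat.
      rewrite [nth s0 (_ :: _ ++ _) _]/= nth_cat /= szt xn ltnS ltnW //.
      have /pathP -/(_ s0 x) : dpath s0 (take n p0).
        by move: d0; rewrite -[p0 in rcons p0](cat_take_drop n) rcons_cat cat_path => /andP[].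
      by rewrite szt; apply.
    have xE : nat_of_ord x = n + 0 by apply/eqP; rewrite addn0 eqn_leq xle.
    have {}yE : nat_of_ord y = n + 1 by rewrite yE xE addn0 addn1.
    rewrite (phiE x 0) 1?(phiE y 1) ?xE ?yE ?b0 //.
    by move: d0; rewrite -[p0 in rcons p0](cat_take_drop n) rcons_cat cat_path => /andP[].
  - move=> /eqP xE; rewrite (phiE x 2) 1?(phiE y 1) ?xE ?yE ?b1 //.
  - move=> /eqP xE; rewrite (phiE x 2) 1?(phiE y 3) ?xE ?yE ?b2 //.
  - move=> /eqP xE; rewrite (phiE x 4) 1?(phiE y 3) ?xE ?yE ?b3 //.
  - move=> /eqP xE; rewrite (phiE x 4) 1?(phiE y 5) ?xE ?yE ?b4 //.
  - move=> /eqP xE; rewrite (phiE y 5) ?yE ?xE ?b5 ?addnS // /phi xE; exact: d5.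
- move=> x y _; rewrite /P.
  have us : all uniq ps by move: (uniq_flatten_all uLps) => /andP[].
  have [bl|bl] := ltnP (b x y) (size ps); first exact/(allP us)/mem_nth.
  by rewrite nth_default.
- move=> x y z xy; apply/negP => zP.
  have := @uniq_flatten_nth _ (L :: ps) 0 (b x y).+1 (phi z) uLps.
  by move=> /(_ (mem_nth _ (ltL z)) zP).
- move=> x y x' y' /darc_oriented6 xy /darc_oriented6 xy' ne; apply/hasPn => v vP'.
  apply/negP => vP.
  have [bE] := @uniq_flatten_nth _ (L :: ps) _.+1 _.+1 v uLps vP vP'.
  have bn : b x y != 6 by apply: contraTneq vP; rewrite /= /P => ->.
  have := b_inv _ _ bn; rewrite bE -b_inv -?bE // => -[xE yE].
  by case/eqP: ne; congr pair; apply: val_inj.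
Qed.
End SixBlocks.
(** * Out-trees with levels *)

Lemma iota_rcons m n : iota m n.+1 = rcons (iota m n) (m + n).
Proof. by rewrite -addn1 iotaD cats1. Qed.

Section Tree.
Variables (D : digraph) (par : D -> D) (lev : D -> nat).
Local Notation dpath := (path (@darc D)).

(* The root is the vertex of level 0, where par is arbitrary. *)
Definition out_tree : Prop :=
  (forall v w, lev v = 0 -> lev w = 0 -> v = w) /\
  (forall v, 0 < lev v -> darc (par v) v /\ lev v = (lev (par v)).+1).

Definition up v n := iter (lev v - n) par v.
Definition anc a v := (lev a <= lev v) && (up v (lev a) == a).
(* The tree path from a to v without a (below_path) or without v (above_path). *)
Definition below_path a v := [seq up v n | n <- iota (lev a).+1 (lev v - lev a)].
Definition above_path a v := [seq up v n | n <- iota (lev a) (lev v - lev a)].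

Hypothesis treeT : out_tree.

Lemma lev_par v : 0 < lev v -> lev v = (lev (par v)).+1.
Proof. by case/treeT.2. Qed.

Lemma darc_par v : 0 < lev v -> darc (par v) v.
Proof. by case/treeT.2. Qed.

Lemma lev_iter v m : m <= lev v -> lev (iter m par v) = lev v - m.
Proof.
elim: m => [|m IHm] lt /=; first by rewrite subn0.
by have := IHm (ltnW lt); have := @lev_par (iter m par v); lia.
Qed.

Lemma lev_up v n : n <= lev v -> lev (up v n) = n.
Proof. by move=> le; rewrite lev_iter ?leq_subr // subKn. Qed.

Lemma up_lev v : up v (lev v) = v.
Proof. by rewrite /up subnn. Qed.

Lemma up_up v n m : n <= m -> m <= lev v -> up (up v m) n = up v n.
Proof. by move=> nm mv; rewrite /up lev_up // -iterD; congr iter; lia. Qed.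

Lemma anc_refl v : anc v v.
Proof. by rewrite /anc leqnn up_lev eqxx. Qed.

Lemma anc_lev a v : anc a v -> lev a <= lev v.
Proof. by case/andP. Qed.

Lemma anc_up v n : n <= lev v -> anc (up v n) v.
Proof. by move=> le; rewrite /anc lev_up // le eqxx. Qed.

Lemma anc_trans b a v : anc a b -> anc b v -> anc a v.
Proof.
move=> /andP[ab /eqP ua] /andP[bv /eqP ub].
by rewrite /anc (leq_trans ab bv) -(up_up ab bv) ub ua eqxx.
Qed.

Lemma anc_total a b v : anc a v -> anc b v -> lev a <= lev b -> anc a b.
Proof.
move=> /andP[av /eqP ua] /andP[bv /eqP ub] ab.
by rewrite /anc ab -{1}ub up_up // ua eqxx.
Qed.

Lemma anc_eq a v : anc a v -> lev v <= lev a -> a = v.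
Proof.
case/andP=> av /eqP ua va.
by rewrite -{1}ua (_ : lev a = lev v) ?up_lev //; lia.
Qed.

Lemma anc_lt a v : anc a v -> a != v -> lev a < lev v.
Proof. by move=> av; apply: contraNltn => ?; apply/eqP/anc_eq. Qed.

Lemma anc_antisym a v : anc a v -> anc v a -> a = v.
Proof. by move=> av /anc_lev; apply: anc_eq. Qed.

Lemma darc_up v n : n < lev v -> darc (up v n) (up v n.+1).
Proof.
move=> lt; rewrite (_ : up v n = par (up v n.+1)) ?darc_par ?lev_up //.
by rewrite /up -iterS; congr iter; lia.
Qed.

Lemma par_anc v : 0 < lev v -> anc (par v) v.
Proof.
move=> /lev_par lp; have -> : par v = up v (lev (par v)) by rewrite /up lp subSnn.
by apply: anc_up; rewrite lp leqnSn.
Qed.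

Lemma anc_par a v : anc a v -> a != v -> anc a (par v).
Proof.
move=> av ne; have v_gt0 := leq_ltn_trans (leq0n _) (anc_lt av ne).
apply: (anc_total av (par_anc v_gt0)).
by rewrite -ltnS -lev_par // (anc_lt av ne).
Qed.

Lemma path_up v m j : m + j <= lev v ->
  dpath (up v m) [seq up v n | n <- iota m.+1 j].
Proof.
by elim: j m => //= j IHj m le; rewrite darc_up ?IHj //; lia.
Qed.

Lemma uniq_up v m j : m + j <= (lev v).+1 -> uniq [seq up v n | n <- iota m j].
Proof.
move=> le; rewrite map_inj_in_uniq ?iota_uniq // => a b.
rewrite !mem_iota => ha hb /(congr1 lev); rewrite !lev_up //; lia.
Qed.

Lemma below_path_path a v y : anc a v -> darc v y ->
  dpath a (rcons (below_path a v) y).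
Proof.
case/andP=> le /eqP ua vy; rewrite rcons_path -{1}ua path_up ?subnKC //=.
rewrite /below_path; case: (ltngtP (lev a) (lev v)) le => // [lt|eq] _.
  have -> : lev v - lev a = (lev v - lev a).-1.+1 by lia.
  rewrite iota_rcons map_rcons last_rcons.
  by rewrite (_ : _ + _ = lev v) ?up_lev //; lia.
by rewrite eq subnn /= -ua eq up_lev.
Qed.

Lemma above_path_path x a v : darc x a -> anc a v ->
  dpath x (rcons (above_path a v) v).
Proof.
move=> xa /andP[le /eqP ua].
rewrite -{2}(up_lev v) -map_rcons -[X in rcons _ X](subnKC le) -iota_rcons /= ua xa.
by rewrite -{1}ua path_up ?subnKC.
Qed.

Lemma uniq_below_path a v : anc a v -> uniq (below_path a v).
Proof. by move=> /anc_lev le; apply: uniq_up; lia. Qed.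

Lemma uniq_above_path a v : anc a v -> uniq (above_path a v).
Proof. by move=> /anc_lev le; apply: uniq_up; lia. Qed.

Lemma size_below_path a v : size (below_path a v) = lev v - lev a.
Proof. by rewrite size_map size_iota. Qed.

Lemma size_above_path a v : size (above_path a v) = lev v - lev a.
Proof. by rewrite size_map size_iota. Qed.

Lemma mem_below_path a v w : anc a v ->
  (w \in below_path a v) = [&& anc a w, anc w v & w != a].
Proof.
move=> av; have le := anc_lev av; apply/mapP/and3P.
  case=> n; rewrite mem_iota => hn ->.
  have nv : n <= lev v by lia.
  split; [by apply: (anc_total av (anc_up nv)); rewrite lev_up //; lia | exact: anc_up |].
  by apply/eqP => /(congr1 lev); rewrite lev_up //; lia.
case=> aw wv ne; exists (lev w); last by case/andP: wv => _ /eqP.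
have := anc_lev wv; rewrite eq_sym in ne; have := anc_lt aw ne.
by rewrite mem_iota; lia.
Qed.

Lemma mem_above_path a v w : anc a v ->
  (w \in above_path a v) = [&& anc a w, anc w v & w != v].
Proof.
move=> av; have le := anc_lev av; apply/mapP/and3P.
  case=> n; rewrite mem_iota => hn ->.
  have nv : n <= lev v by lia.
  split; [by apply: (anc_total av (anc_up nv)); rewrite lev_up //; lia | exact: anc_up |].
  by apply/eqP => /(congr1 lev); rewrite lev_up //; lia.
case=> aw wv ne; exists (lev w); last by case/andP: wv => _ /eqP.
by have := anc_lt wv ne; have := anc_lev aw; rewrite mem_iota; lia.
Qed.

Lemma exists_lca a b : exists z,
  [/\ anc z a, anc z b & forall w, anc w a -> anc w b -> lev w <= lev z].
Proof.
have r0 : anc (up a 0) a && anc (up a 0) b.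
  rewrite anc_up //= (_ : up a 0 = up b 0) ?anc_up //.
  by apply: treeT.1; rewrite lev_up.
case: (arg_maxnP (P := fun z => anc z a && anc z b) lev r0) => z /andP[za zb] zmax.
by exists z; split=> // w wa wb; apply: zmax; rewrite wa wb.
Qed.

End Tree.

(** * Cycles among arcs of one type *)

Section MinDegree.
Variable T : finType.
Implicit Types (E : {set T * T}) (A B : {set T}).

Definition outs E v := [set w | (v, w) \in E].
Definition ins E w := [set v | (v, w) \in E].

Lemma exists_min_degree_aux p q E A B : E \subset setX A B ->
  p * #|A| + q * #|B| < #|E| ->
  exists E', [/\ E' \subset E, E' != set0 &
    forall v w, (v, w) \in E' -> p < #|outs E' v| /\ q < #|ins E' w|].
Proof.
move: {2}(#|A| + #|B|) (leqnn (#|A| + #|B|)) => n.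
elim: n E A B => [|n IHn] E A B leAB sEAB ltE.
  have E_gt0 : 0 < #|E| by apply: leq_ltn_trans ltE.
  have /subset_leq_card := sEAB; rewrite cardsX; nia.
have del_out v : v \in A -> #|outs E v| <= p ->
    exists E', [/\ E' \subset E, E' != set0 &
      forall v w, (v, w) \in E' -> p < #|outs E' v| /\ q < #|ins E' w|].
  move=> vA dv; pose X := [set (v, w) | w in outs E v].
  have cX : #|X| = #|outs E v| by rewrite card_imset // => a b [].
  have cA : #|A| = #|A :\ v|.+1 by rewrite (cardsD1 v) vA.
  have leE : #|E| <= #|E :\: X| + p.
    rewrite -(cardsID X E) addnC leq_add2l (leq_trans (subset_leq_card (subsetIr _ _))) //.
    by rewrite cX.
  have [||//| E' [sE' nzE' dE']] := IHn (E :\: X) (A :\ v) B.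
  - by move: leAB; rewrite cA; lia.
  - apply/subsetP => -[a b]; rewrite !inE => /andP[nX abE].
    have := subsetP sEAB _ abE; rewrite inE => /andP[/= -> ->].
    rewrite !andbT; apply: contraNneq nX => av.
    by apply/imsetP; exists b; rewrite ?inE -?av.
  - by move: ltE leE; rewrite cA mulnS; lia.
  - by exists E'; split=> //; apply: subset_trans sE' (subsetDl _ _).
have del_in w : w \in B -> #|ins E w| <= q ->
    exists E', [/\ E' \subset E, E' != set0 &
      forall v w, (v, w) \in E' -> p < #|outs E' v| /\ q < #|ins E' w|].
  move=> wB dw; pose X := [set (v, w) | v in ins E w].
  have cX : #|X| = #|ins E w| by rewrite card_imset // => a b [].
  have cB : #|B| = #|B :\ w|.+1 by rewrite (cardsD1 w) wB.
  have leE : #|E| <= #|E :\: X| + q.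
    rewrite -(cardsID X E) addnC leq_add2l (leq_trans (subset_leq_card (subsetIr _ _))) //.
    by rewrite cX.
  have [||//| E' [sE' nzE' dE']] := IHn (E :\: X) A (B :\ w).
  - by move: leAB; rewrite cB; lia.
  - apply/subsetP => -[a b]; rewrite !inE => /andP[nX abE].
    have := subsetP sEAB _ abE; rewrite inE => /andP[/= -> ->].
    rewrite !andbT /=; apply: contraNneq nX => bw.
    by apply/imsetP; exists a; rewrite ?inE -?bw.
  - by move: ltE leE; rewrite cB mulnS; lia.
  - by exists E'; split=> //; apply: subset_trans sE' (subsetDl _ _).
case: (boolP [exists v in A, #|outs E v| <= p]) => [/exists_inP[v]|/exists_inPn nA].
  exact: del_out.
case: (boolP [exists w in B, #|ins E w| <= q]) => [/exists_inP[w]|/exists_inPn nB].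
  exact: del_in.
exists E; split=> // [|v w vwE]; first by rewrite -card_gt0 (leq_ltn_trans _ ltE).
have := subsetP sEAB _ vwE; rewrite inE => /andP[/= vA wB].
by rewrite !ltnNge nA // nB.
Qed.

Lemma exists_min_degree p q E A : E \subset setX A A ->
  (p + q) * #|A| < #|E| ->
  exists E', [/\ E' \subset E, E' != set0 &
    forall v w, (v, w) \in E' -> p < #|outs E' v| /\ q < #|ins E' w|].
Proof. by move=> sE; rewrite mulnDl; apply: exists_min_degree_aux. Qed.

End MinDegree.
Lemma uniq_cat4 (T : eqType) (V p q r : seq T) :
  uniq V -> uniq p -> uniq q -> uniq r ->
  {in p, forall v, [/\ v \notin V, v \notin q & v \notin r]} ->
  {in q, forall v, v \notin V /\ v \notin r} ->
  {in r, forall v, v \notin V} ->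
  uniq (V ++ p ++ q ++ r).
Proof.
move=> uV up uq ur hp hq hr; rewrite !cat_uniq uV up uq ur !has_cat !negb_or !andbT /=.
by repeat (apply/andP; split); apply/hasPn => v /= hv;
  [case: (hp v)|case: (hq v)|apply: hr|apply/negP => /hp[]|apply/negP => /hp[]|apply/negP => /hq[]];
  rewrite ?hv //; move: hv; rewrite ?inE => -> .
Qed.
Lemma neq_sym (T : eqType) (x y : T) : x != y -> y != x.
Proof. by rewrite eq_sym. Qed.

Lemma sort3 (T : Type) (f : T -> nat) (P : T -> Prop) (R : T -> T -> Prop) x y z :
  (forall u v, R u v -> R v u) -> P x -> P y -> P z -> R x y -> R y z -> R z x ->
  exists a b c, [/\ P a, P b & P c] /\
    [/\ R a b, R b c, R c a, f a <= f b & f b <= f c].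
Proof.
move=> Rsym Px Py Pz xy yz zx; have [yx zy xz] := And3 (Rsym _ _ xy) (Rsym _ _ yz) (Rsym _ _ zx).
case: (leqP (f x) (f y)) => hxy; case: (leqP (f y) (f z)) => hyz;
  case: (leqP (f x) (f z)) => hxz.
- by exists x, y, z.
- by exists x, y, z.
- by exists x, z, y; do !split=> //; exact: ltnW.
- by exists z, x, y; do !split=> //; exact: ltnW.
- by exists y, x, z; do !split=> //; exact: ltnW.
- by exists y, z, x; do !split=> //; exact: ltnW.
- by exists y, x, z; do !split=> //; exact: ltnW.
- by exists z, y, x; do !split=> //; exact: ltnW.
Qed.

(* lia splits on every boolean hypothesis, so only inequalities are kept. *)
Ltac lev_lia :=
  repeat match goal with H : is_true ?b |- _ =>
    lazymatch b with
    | leq _ _ => fail | andb (leq _ _) (leq _ _) => fail | _ => clear H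
    end end; lia.

Section Cycles.
Variables (D : digraph) (par : D -> D) (lev : D -> nat) (k : nat).
Hypothesis treeT : out_tree par lev.
Hypothesis k_gt0 : 0 < k.
Local Notation anc := (anc par lev).
Local Notation below_path := (below_path par lev).
Local Notation above_path := (above_path par lev).
Local Notation dpath := (path (@darc D)).
Local Notation C6 := (oriented_cycle [:: k; 1; 1; 1; 1; 1]).

Lemma mod_gap m n : m < n -> m = n %[mod k] -> k <= n - m.
Proof.
move=> lt /eqP; rewrite eq_sym (eqn_mod_dvd _ (ltnW lt)).
by apply: dvdn_leq; rewrite subn_gt0.
Qed.

Lemma notin_lev v (s : seq D) : lev v \notin map lev s -> v \notin s.
Proof. exact/contra/map_f. Qed.

Lemma neq_lev v w : lev v != lev w -> v != w.
Proof. by apply: contraNneq => ->. Qed.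

Lemma lev_below_path z a v : v \in below_path z a -> lev z < lev v <= lev a.
Proof.
by case/mapP=> n; rewrite mem_iota => hn ->; rewrite (lev_up treeT); lia.
Qed.

Lemma lev_above_path a s v : v \in above_path a s -> lev a <= lev v < lev s.
Proof.
by case/mapP=> n; rewrite mem_iota => hn ->; rewrite (lev_up treeT); lia.
Qed.

Lemma ancestors_forward_cycle x y1 y2 y3 a b c d :
  darc x y1 -> darc x y3 -> darc a y1 -> darc b y2 -> darc c y2 -> darc d y3 ->
  y1 != y2 -> y2 != y3 -> y3 != y1 ->
  lev x < lev y1 -> lev x < lev y2 -> lev x < lev y3 ->
  anc a b -> anc c x -> anc d x ->
  k <= lev b - lev a -> lev b < lev c -> lev b < lev d ->
  lev c < lev x -> lev d < lev x ->
  contains_subdivision D C6.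
Proof.
move=> xy1 xy3 ay1 by2 cy2 dy3 n12 n23 n31 l1 l2 l3 ab cx dx kab bc bd lcx ldx.
have [z [zc zd zcd]] : exists z, [/\ anc z c, anc z d & z = c \/ z = d].
  case: (leqP (lev c) (lev d)) => [le|/ltnW le].
    by exists c; split; [exact: anc_refl|exact: anc_total cx dx le|left].
  by exists d; split; [exact: anc_total dx cx le|exact: anc_refl|right].
have lz : lev b < lev z < lev x by case: zcd => ->; rewrite (bc, bd) (lcx, ldx).
have lzc := anc_lev zc; have lzd := anc_lev zd.
have U : uniq ([:: a; y2; z; y3; x; y1] ++
    below_path a b ++ below_path z c ++ below_path z d).
  apply: uniq_cat4; try exact: uniq_below_path.
  - rewrite /= !inE !negb_or; repeat (apply/andP; split);
      by [|rewrite eq_sym|apply: neq_lev; lev_lia].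
  - move=> v /lev_below_path vp; split; first by apply: notin_lev; rewrite /= !inE; lev_lia.
      by apply/negP => /lev_below_path; lev_lia.
    by apply/negP => /lev_below_path; lev_lia.
  - move=> v /lev_below_path vp; split; first by apply: notin_lev; rewrite /= !inE; lev_lia.
    by apply/negP => /lev_below_path; case: zcd => ?; subst z; lev_lia.
  - by move=> v /lev_below_path vp; apply: notin_lev; rewrite /= !inE; lev_lia.
apply: (@contains_six_blocks_first D k a y2 z y3 x y1
  (below_path a b) (below_path z c) (below_path z d) [::] [::] [::]) => //;
  rewrite /= ?cats0 ?andbT //; try exact: below_path_path.
by rewrite size_below_path (leq_trans kab).
Qed.

Lemma ancestors_backward_cycle x y1 y2 y3 a b c d :
  darc y1 x -> darc y3 x -> darc y1 a -> darc y2 b -> darc y2 c -> darc y3 d ->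
  y1 != y2 -> y2 != y3 -> y3 != y1 ->
  lev x < lev y1 -> lev x < lev y2 -> lev x < lev y3 ->
  anc a b -> anc c x -> anc d x ->
  k <= lev b - lev a -> lev b < lev c -> lev b < lev d ->
  lev c < lev x -> lev d < lev x ->
  contains_subdivision D C6.
Proof.
move=> xy1 xy3 ay1 by2 cy2 dy3 n12 n23 n31 l1 l2 l3 ab cx dx kab bc bd lcx ldx.
have [z [zc zd zcd]] : exists z, [/\ anc c z, anc d z & z = c \/ z = d].
  case: (leqP (lev c) (lev d)) => [le|/ltnW le].
    by exists d; split; [exact: anc_total cx dx le|exact: anc_refl|right].
  by exists c; split; [exact: anc_refl|exact: anc_total dx cx le|left].
have lz : lev b < lev z < lev x by case: zcd => ->; rewrite (bc, bd) (lcx, ldx).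
have lzc := anc_lev zc; have lzd := anc_lev zd; have lab := anc_lev ab.
have U : uniq ([:: y1; b; y2; z; y3; x] ++
    above_path a b ++ above_path c z ++ above_path d z).
  apply: uniq_cat4; try exact: uniq_above_path.
  - rewrite /= !inE !negb_or; repeat (apply/andP; split);
      by [|rewrite eq_sym|apply: neq_lev; lev_lia].
  - move=> v /lev_above_path vp; split; first by apply: notin_lev; rewrite /= !inE; lev_lia.
      by apply/negP => /lev_above_path; lev_lia.
    by apply/negP => /lev_above_path; lev_lia.
  - move=> v /lev_above_path vp; split; first by apply: notin_lev; rewrite /= !inE; lev_lia.
    by apply/negP => /lev_above_path; case: zcd => ?; subst z; lev_lia.
  - by move=> v /lev_above_path vp; apply: notin_lev; rewrite /= !inE; lev_lia.
apply: (@contains_six_blocks_first D k y1 b y2 z y3 x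
  (above_path a b) [::] (above_path c z) (above_path d z) [::] [::]) => //;
  rewrite /= ?cats0 ?andbT //; try exact: above_path_path.
by rewrite size_above_path (leq_trans kab).
Qed.

Lemma neq_anc v t w : ~~ anc v w -> anc t w -> t != v.
Proof. by move=> nv; apply: contraTneq => ->. Qed.

(* The cycle runs from z, a lowest common ancestor of a and w, down the tree to
   w, then through u, s, P backwards, x, y, a and up the tree to z. *)
Lemma cross_cycle_tree_long x u y s w a P :
  dpath x (rcons P s) -> darc x y -> darc u s -> darc u w -> darc a y ->
  uniq P -> {in P, forall v, [/\ lev x < lev v, ~~ anc v w & v != s]} ->
  y \notin P -> y != s -> x != u -> a != x -> a != u ->
  lev a <= lev u -> lev u <= lev x -> lev x < lev y -> lev x < lev s ->
  ~~ anc x w -> ~~ anc u w -> ~~ anc s w -> ~~ anc y w ->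
  k <= lev w - lev a ->
  contains_subdivision D C6.
Proof.
move=> xPs xy us uw ay uP hP yP ys xu ax au lau lux lxy lxs nx nu ns ny ka.
have [z [za zw zmax]] := exists_lca treeT a w.
have lza := anc_lev za.
have zw_neq : z != w by apply: neq_lev; lev_lia.
have w_gt0 : 0 < lev w by lev_lia.
have lpw := lev_par treeT w_gt0.
have zpw := anc_par treeT zw zw_neq.
have above_w v : v \in below_path z (par w) -> anc v w.
  rewrite mem_below_path // => /and3P[_ vw _].
  exact: anc_trans vw (par_anc treeT w_gt0).
have U : uniq ([:: z; w; u; s; x; y] ++ below_path z (par w) ++ P ++ below_path z a).
  apply: uniq_cat4; rewrite ?uniq_below_path //.
  - rewrite /= !inE !negb_or zw_neq (neq_anc nu zw) (neq_anc ns zw) (neq_anc nx zw).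
    rewrite (neq_anc ny zw) !(neq_anc _ (anc_refl par lev w)) // (eq_sym u x) xu.
    rewrite (eq_sym s y) ys; repeat (apply/andP; split=> //); by apply: neq_lev; lev_lia.
  - move=> v vI; have vw := above_w v vI; have vl := lev_below_path vI.
    have vw_neq : v != w by apply: neq_lev; lev_lia.
    have vz_neq : v != z by apply: neq_lev; lev_lia.
    split.
    + by rewrite !inE !negb_or vw_neq vz_neq !(neq_anc _ vw).
    + by apply/negP => /hP[_ /negP[]].
    + rewrite mem_below_path //; apply/negP => /and3P[_ va _].
      by have := zmax v va vw; lev_lia.
  - move=> v vP; have [lv nv vs] := hP v vP; split.
      rewrite !inE !negb_or (eq_sym v z) (neq_anc nv zw) (eq_sym v w).
      have vy : v != y by apply: contraTneq vP => ->.
      rewrite (neq_anc nv (anc_refl par lev w)) vs vy.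
      by repeat (apply/andP; split=> //); apply: neq_lev; lev_lia.
    by apply/negP => /lev_below_path; lev_lia.
  - move=> v vI; have vl := lev_below_path vI.
    have va : anc v a by move: vI; rewrite mem_below_path // => /and3P[].
    have vu : v != u.
      by apply: contraNneq au => vu; rewrite -vu (anc_eq va) // vu.
    have vx : v != x.
      by apply: contraNneq ax => vx; rewrite -vx (anc_eq va) // vx (leq_trans lau).
    rewrite !inE !negb_or vu vx; repeat (apply/andP; split=> //);
      by apply: neq_lev; lev_lia.
apply: (@contains_six_blocks_first D k z w u s x y
  (below_path z (par w)) [::] [::] P [::] (below_path z a)) => //;
  rewrite /= ?cats0 ?andbT //; try exact: below_path_path.
  exact: (below_path_path treeT zpw (darc_par treeT w_gt0)).
by rewrite size_below_path; lev_lia.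
Qed.

(* Here z is a lowest common ancestor of a and b, and the cycle runs along P
   from x to p, then through u, q, b, up to z, down to a, and through y to x. *)
Lemma cross_cycle_path_long x u y p q a b P :
  dpath x (rcons P p) -> darc x y -> darc u p -> darc u q -> darc a y -> darc b q ->
  uniq P -> {in P, forall v, lev x < lev v /\ v != p} ->
  y \notin P -> q \notin P -> y != p -> y != q -> q != p -> x != u ->
  a != x -> a != u -> b != x -> b != u ->
  lev a <= lev u -> lev b <= lev u -> lev u <= lev x ->
  lev x < lev y -> lev x < lev p -> lev x < lev q ->
  k <= (size P).+1 ->
  contains_subdivision D C6.
Proof.
move=> xPp xy up uq ay bq uP hP yP qP yp yq qp xu ax au bx bu.
move=> lau lbu lux lxy lxp lxq kP.
have [z [za zb zmax]] := exists_lca treeT a b.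
have lza := anc_lev za; have lzb := anc_lev zb.
have low c v : c != x -> c != u -> lev c <= lev u -> anc v c -> v != x /\ v != u.
  move=> cx cu lcu vc; split.
    by apply: contraNneq cx => vx; rewrite -vx (anc_eq vc) // vx (leq_trans lcu).
  by apply: contraNneq cu => vu; rewrite -vu (anc_eq vc) // vu.
have [zx zu] := low a z ax au lau za.
have U : uniq ([:: x; p; u; q; z; y] ++ P ++ below_path z b ++ below_path z a).
  apply: uniq_cat4; rewrite ?uniq_below_path //.
  - rewrite /= !inE !negb_or xu (eq_sym x z) zx (eq_sym u z) zu (eq_sym p y) yp.
    rewrite (eq_sym q y) yq (eq_sym p q) qp.
    by repeat (apply/andP; split=> //); apply: neq_lev; lev_lia.
  - move=> v vP; have [lv vp] := hP v vP; split.
    + have [vy vq] : v != y /\ v != q.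
        by split; apply: contraTneq vP => ->.
      rewrite !inE !negb_or vp vy vq.
      by repeat (apply/andP; split=> //); apply: neq_lev; lev_lia.
    + by apply/negP => /lev_below_path; lev_lia.
    + by apply/negP => /lev_below_path; lev_lia.
  - move=> v vI; have vl := lev_below_path vI.
    have vb : anc v b by move: vI; rewrite mem_below_path // => /and3P[].
    have [vx vu] := low b v bx bu lbu vb; split.
      by rewrite !inE !negb_or vu vx; repeat (apply/andP; split=> //);
        apply: neq_lev; lev_lia.
    rewrite mem_below_path //; apply/negP => /and3P[_ va _].
    by have := zmax v va vb; lev_lia.
  - move=> v vI; have vl := lev_below_path vI.
    have va : anc v a by move: vI; rewrite mem_below_path // => /and3P[].
    have [vx vu] := low a v ax au lau va.
    by rewrite !inE !negb_or vu vx; repeat (apply/andP; split=> //);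
      apply: neq_lev; lev_lia.
by apply: (@contains_six_blocks_first D k x p u q z y
  P [::] [::] (below_path z b) (below_path z a) [::]) => //;
  rewrite /= ?cats0 ?andbT //; try exact: below_path_path.
Qed.

Variable E : {set D * D}.
Hypothesis E_neq0 : E != set0.
Hypothesis E_deg : forall v w, (v, w) \in E -> 4 < #|outs E v| /\ 3 < #|ins E w|.
Hypothesis E_lev : forall v w, (v, w) \in E -> lev v < lev w.
Variable r : nat.
Hypothesis E_mod : forall v w, (v, w) \in E -> lev v %% k = r /\ lev w %% k = r.

Lemma exists_max_tail : exists x, (exists y, (x, y) \in E) /\
  forall v w, (v, w) \in E -> lev v <= lev x.
Proof.
have [[x0 y0] xy0] := set0Pn _ E_neq0.
have P0 : x0 \in [set e.1 | e in E] by apply/imsetP; exists (x0, y0).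
case: (arg_maxnP (P := [in [set e.1 | e in E]]) lev P0) => _ /imsetP[[x y] xy ->] xmax.
exists x; split; first by exists y.
by move=> v w vw; apply: xmax; apply/imsetP; exists (v, w).
Qed.

Section Comparable.
Hypothesis E_anc : forall v w, (v, w) \in E -> anc v w.

Lemma exists_triple x y : (x, y) \in E ->
  (forall v w, (v, w) \in E -> lev v <= lev x) ->
  exists a b c, [/\ (a, y) \in E, (b, y) \in E, (c, y) \in E &
    lev a < lev b /\ lev b < lev c < lev x].
Proof.
move=> xy xmax; have [_ dy] := E_deg xy.
have : 2 < #|ins E y :\ x| by move: dy; rewrite (cardsD1 x) inE xy.
have lt v w : (v, y) \in E -> (w, y) \in E -> v != w -> lev v < lev w \/ lev w < lev v.
  move=> /E_anc vy /E_anc wy ne; case: (ltngtP (lev v) (lev w)); [by left|by right|].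
  move=> eq; case/eqP: ne; apply: (anc_eq (par := par) (lev := lev)); last by rewrite eq.
  by apply: (anc_total treeT vy wy); rewrite eq.
case/card_gt2P=> u [v [w []]]; rewrite !inE => -[/andP[ux uy] /andP[vx vy] /andP[wx wy]].
case=> uv vw wu.
have ne s t : (s, y) \in E -> (t, y) \in E -> s != t -> lev s != lev t.
  by move=> sy ty /(lt _ _ sy ty)[] h; rewrite neq_ltn h ?orbT.
have [a [b [c [[[ax ay] [bx bY] [cx cy]] [ab bc _ leab lebc]]]]] :=
  sort3 lev (P := fun v => v != x /\ (v, y) \in E)
    (R := fun v w => v != w) (@neq_sym _) (conj ux uy) (conj vx vy) (conj wx wy) uv vw wu.
have := (ne _ _ ay bY ab, ne _ _ bY cy bc, ne _ _ cy xy cx, xmax _ _ cy).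
move=> [[[nab nbc] ncx] lcx]; exists a, b, c; split=> //.
by rewrite !ltn_neqAle nab leab nbc lebc ncx.
Qed.

(* Give each of y1, y2, y3 three upper neighbours above x, and sort the y's by
   the level of the middle one: the tree segments from a to b and between c and d
   are then disjoint. *)
Lemma exists_interleaving : exists x y1 y2 y3 a b c d,
  [/\ [/\ (x, y1) \in E, (x, y2) \in E & (x, y3) \in E],
      [/\ y1 != y2, y2 != y3 & y3 != y1],
      [/\ (a, y1) \in E, (b, y2) \in E, (c, y2) \in E & (d, y3) \in E] &
      [/\ lev a < lev b, lev b < lev c, lev b < lev d, lev c < lev x & lev d < lev x]].
Proof.
have [x [[y0 xy0] xmax]] := exists_max_tail.
have : 2 < #|outs E x| by have [+ _] := E_deg xy0; apply: leq_trans.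
case/card_gt2P=> y1 [y2 [y3 []]]; rewrite !inE => -[xy1 xy2 xy3] [n12 n23 n31].
have [a1 [b1 [c1 h1]]] := exists_triple xy1 xmax.
have [a2 [b2 [c2 h2]]] := exists_triple xy2 xmax.
have [a3 [b3 [c3 h3]]] := exists_triple xy3 xmax.
have [t1 [t2 [t3 []]]] := sort3 (fun t : D * D * D * D => lev t.1.2)
  (P := fun t => let: (y, a, b, c) := t in (x, y) \in E /\
    [/\ (a, y) \in E, (b, y) \in E, (c, y) \in E & lev a < lev b /\ lev b < lev c < lev x])
  (R := fun t t' => t.1.1.1 != t'.1.1.1) (x := (y1, a1, b1, c1)) (y := (y2, a2, b2, c2))
  (z := (y3, a3, b3, c3)) (fun _ _ => @neq_sym _ _ _)
  (conj xy1 h1) (conj xy2 h2) (conj xy3 h3) n12 n23 n31.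
case: t1 t2 t3 => [[[{xy1 h1 n12 n31}y1 {}a1] {}b1] {}c1]
  [[[{xy2 h2 n23}y2 {}a2] {}b2] {}c2] [[[{xy3 h3}y3 {}a3] {}b3] {}c3] /=.
case=> -[xy1 [ay1 by1 cy1 [ab1 bc1]]] [xy2 [ay2 by2 cy2 [ab2 /andP[bc2 cx2]]]].
move=> [xy3 [ay3 by3 cy3 [ab3 /andP[bc3 cx3]]]] [n12 n23 n31 b12 b23].
exists x, y1, y2, y3, a1, b2, c2, c3; split=> //; split=> //.
- exact: leq_trans ab1 b12.
- exact: leq_ltn_trans b23 bc3.
Qed.

End Comparable.

Lemma ancestors_forward_contains :
  (forall v w, (v, w) \in E -> anc v w /\ darc v w) -> contains_subdivision D C6.
Proof.
move=> hE; have hanc v w vw := (hE v w vw).1.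
have [x [y1 [y2 [y3 [a [b [c [d []]]]]]]]] := exists_interleaving hanc.
move=> [xy1 xy2 xy3] [n12 n23 n31] [ay1 by2 cy2 dy3] [ab bc bd cx dx].
have [lx1 lx2 lx3] := And3 (E_lev xy1) (E_lev xy2) (E_lev xy3).
have above v y : (v, y) \in E -> (x, y) \in E -> lev v < lev x -> anc v x.
  by move=> /hanc vy /hanc xy /ltnW; exact: anc_total vy xy.
have ax : anc a x by apply: above ay1 xy1 _; exact: ltn_trans ab (ltn_trans bc cx).
have bx : anc b x by apply: above by2 xy2 _; exact: ltn_trans bc cx.
apply: (@ancestors_forward_cycle x y1 y2 y3 a b c d) => //;
  try exact: (hE _ _ _).2.
- exact: anc_total ax bx (ltnW ab).
- exact: above cy2 xy2 cx.
- exact: above dy3 xy3 dx.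
- by apply: mod_gap ab _; rewrite (E_mod ay1).1 (E_mod by2).1.
Qed.

Lemma ancestors_backward_contains :
  (forall v w, (v, w) \in E -> anc v w /\ darc w v) -> contains_subdivision D C6.
Proof.
move=> hE; have hanc v w vw := (hE v w vw).1.
have [x [y1 [y2 [y3 [a [b [c [d []]]]]]]]] := exists_interleaving hanc.
move=> [xy1 xy2 xy3] [n12 n23 n31] [ay1 by2 cy2 dy3] [ab bc bd cx dx].
have [lx1 lx2 lx3] := And3 (E_lev xy1) (E_lev xy2) (E_lev xy3).
have above v y : (v, y) \in E -> (x, y) \in E -> lev v < lev x -> anc v x.
  by move=> /hanc vy /hanc xy /ltnW; exact: anc_total vy xy.
have ax : anc a x by apply: above ay1 xy1 _; exact: ltn_trans ab (ltn_trans bc cx).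
have bx : anc b x by apply: above by2 xy2 _; exact: ltn_trans bc cx.
apply: (@ancestors_backward_cycle x y1 y2 y3 a b c d) => //;
  try exact: (hE _ _ _).2.
- exact: anc_total ax bx (ltnW ab).
- exact: above cy2 xy2 cx.
- exact: above dy3 xy3 dx.
- by apply: mod_gap ab _; rewrite (E_mod ay1).1 (E_mod by2).1.
Qed.

Lemma exists_setD2 (A : {set D}) v w : 2 < #|A| ->
  exists t, [/\ t \in A, t != v & t != w].
Proof.
move=> A3; have : 0 < #|A :\ v :\ w|.
  have := cardsD1 v A; have := cardsD1 w (A :\ v); move: A3.
  have := leq_b1 (v \in A); have := leq_b1 (w \in A :\ v).
  by move: (nat_of_bool _) (nat_of_bool _) #|A| #|A :\ v| #|A :\ v :\ w|; lia.
by case/card_gt0P=> t; rewrite !inE => /and3P[tw tv tA]; exists t.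
Qed.

Section Cross.
Hypothesis E_cross : forall v w, (v, w) \in E -> darc v w /\ ~~ anc v w.

Definition strictly_under x w :=
  (anc x w && (w != x)) || [exists y in outs E x, anc y w].

Lemma strictly_under_outs x y : (x, y) \in E -> strictly_under x y.
Proof.
move=> xy; apply/orP; right; apply/exists_inP.
by exists y; rewrite ?inE ?anc_refl.
Qed.

Lemma strictly_under_trans x v w : strictly_under x v -> anc v w -> strictly_under x w.
Proof.
move=> /orP[/andP[xv vx]|/exists_inP[y yx yv]] vw; apply/orP.
  left; rewrite (anc_trans treeT xv vw); apply: contraNneq vx => wx.
  by rewrite (anc_antisym xv) -?wx // wx.
by right; apply/exists_inP; exists y => //; exact: anc_trans yv vw.
Qed.

Lemma strictly_under_lev x w : strictly_under x w -> lev x < lev w.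
Proof.
case/orP=> [/andP[xw]|/exists_inP[y]]; first by rewrite eq_sym => xw_neq; exact: anc_lt xw xw_neq.
by rewrite inE => /E_lev lt /anc_lev; apply: leq_trans.
Qed.

Lemma strictly_under_path x p : lev p = lev x %[mod k] -> strictly_under x p ->
  exists P y0, [/\ dpath x (rcons P p) /\ uniq P,
    {in P, forall v, [/\ anc v p, v != p & strictly_under x v]},
    forall y, (x, y) \in E -> y != y0 -> y \notin P /\ y != p &
    (x, p) \notin E -> k <= (size P).+1].
Proof.
move=> pxk /orP[/andP[xp px]|/exists_inP[y1 xy1 y1p]].
  have lxp : lev x < lev p by rewrite (anc_lt xp) // eq_sym.
  have p_gt0 : 0 < lev p by lev_lia.
  have lpp := lev_par treeT p_gt0.
  have xpp : anc x (par p) by apply: anc_par; rewrite // eq_sym.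
  have inP v : v \in below_path x (par p) -> [/\ anc x v, anc v p & v != x].
    rewrite mem_below_path // => /and3P[xv vp vx].
    by split=> //; exact: anc_trans vp (par_anc treeT p_gt0).
  exists (below_path x (par p)), x; split.
  - by split; [exact: below_path_path xpp (darc_par treeT p_gt0)|exact: uniq_below_path].
  - move=> v vP; have [xv vp vx] := inP v vP; split=> //.
      by apply: neq_lev; have := lev_below_path vP; lev_lia.
    by rewrite /strictly_under xv vx.
  - move=> y /E_cross[_ nxy] _; split; last by apply: contraNneq nxy => ->.
    by apply: contra nxy => /inP[].
  - move=> _; rewrite size_below_path; have := mod_gap lxp (esym pxk); lev_lia.
have Py1 : (y1 \in outs E x) && anc y1 p by rewrite xy1.
case: (arg_maxnP (P := fun y => (y \in outs E x) && anc y p) lev Py1).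
move=> y /andP[]; rewrite inE => xy yp ymax.
have inP v : v \in above_path y p -> [/\ anc y v, anc v p & v != p].
  by rewrite mem_above_path // => /and3P.
exists (above_path y p), y; split.
- split; last exact: uniq_above_path.
  exact: above_path_path (E_cross xy).1 yp.
- move=> v /inP[yv vp nvp]; split=> //; apply/orP; right.
  by apply/exists_inP; exists y; rewrite ?inE.
- move=> y' xy' ny.
  have le : anc y' p -> lev y' <= lev y by move=> y'p; apply: ymax; rewrite inE xy'.
  split.
    apply/negP => /inP[yy' y'p _]; case/eqP: ny; apply/esym.
    exact: anc_eq yy' (le y'p).
  apply: contraNneq ny => y'E; apply/eqP/esym.
  by apply: (anc_eq (par := par) (lev := lev)); rewrite ?le // y'E ?anc_refl.
- move=> nxp; rewrite size_above_path leqW //; apply: mod_gap.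
    by apply: anc_lt yp _; apply: contraNneq nxp => <-.
  by rewrite pxk (E_mod xy).1 (E_mod xy).2.
Qed.
(* x is a tail of maximal level and u a tail of maximal level among the others
   with an out-neighbour under x, so that all in-neighbours of a vertex under x,
   other than x and u, and the tree paths joining them, avoid x, u and all
   vertices under x. *)
Lemma cross_contains : contains_subdivision D C6.
Proof.
have [x [[y0 xy0] xmax]] := exists_max_tail.
have pick_in v q u : (v, q) \in E -> exists a, [/\ (a, q) \in E, a != x & a != u].
  case/E_deg=> _ /ltnW /(exists_setD2 x u)[a []]; rewrite inE => aq ax au.
  by exists a.
have out_x : 2 < #|outs E x| by have [/ltnW/ltnW] := E_deg xy0.
have [u0 [u0y u0x _]] := pick_in x y0 x xy0.
pose linked v := (v != x) && [exists s in outs E v, strictly_under x s].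
have linked0 : linked u0.
  by rewrite /linked u0x; apply/exists_inP; exists y0; rewrite ?inE ?strictly_under_outs.
case: (arg_maxnP (P := linked) lev linked0) => u /andP[ux /exists_inP[s us xs]] umax.
rewrite inE in us.
have {}umax b q : (b, q) \in E -> b != x -> strictly_under x q -> lev b <= lev u.
  move=> bq bx xq; apply: umax; rewrite /linked bx; apply/exists_inP.
  by exists q; rewrite ?inE.
have lux := xmax u s us; have xu : x != u by rewrite eq_sym.
have modx v w : (v, w) \in E -> lev w = lev x %[mod k].
  by move=> vw; rewrite (E_mod vw).2 (E_mod xy0).1.
case: (boolP [exists w in outs E u, (w != x) && ~~ strictly_under x w]).
  case/exists_inP=> w; rewrite inE => uw /andP[wx nxw].
  have [P [y1 [[xPs uP] hP outP _]]] := strictly_under_path (modx _ _ us) xs.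
  have [y [xy yy1 _]] := exists_setD2 y1 y1 out_x; rewrite inE in xy.
  have [yP ys] := outP y xy yy1.
  have xsy := strictly_under_outs xy.
  have [a [ay ax au]] := pick_in x y u xy.
  have lau := umax a y ay ax xsy.
  have not_anc v : strictly_under x v -> ~~ anc v w.
    by move=> xv; apply: contra nxw; exact: strictly_under_trans.
  apply: (@cross_cycle_tree_long x u y s w a P) => //;
    rewrite ?strictly_under_lev ?(not_anc s) ?(not_anc y) //.
  - exact: (E_cross xy).1.
  - exact: (E_cross us).1.
  - exact: (E_cross uw).1.
  - exact: (E_cross ay).1.
  - by move=> v /hP[_ vs xv]; rewrite strictly_under_lev ?not_anc.
  - by apply: contra nxw => xw; rewrite /strictly_under xw wx.
  - exact: (E_cross uw).2.
  - apply: mod_gap; first exact: leq_ltn_trans lau (E_lev uw).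
    by rewrite (E_mod ay).1 (E_mod uw).2.
move/exists_inPn=> all_under.
have {}all_under w : (w \in outs E u) && (w != x) -> strictly_under x w.
  by case/andP=> uw wx; have := all_under w uw; rewrite wx /= negbK.
pose S := outs E u :\ x.
have inS w : w \in S -> (u, w) \in E /\ strictly_under x w.
  rewrite !inE => /andP[wx uw]; split=> //; apply: all_under; by rewrite inE uw.
case: (boolP [exists p in S, exists q in S,
    [&& p != q, (x, p) \notin E & ~~ anc q p]]).
  case/exists_inP=> p /inS[up xp] /exists_inP[q /inS[uq xq] /and3P[pq nxp nqp]].
  have [P [y1 [[xPp uP] hP outP sP]]] := strictly_under_path (modx _ _ up) xp.
  have [y [xy yy1 yq]] := exists_setD2 y1 q out_x; rewrite inE in xy.
  have [yP yp] := outP y xy yy1.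
  have xsy := strictly_under_outs xy.
  have [a [ay ax au]] := pick_in x y u xy.
  have [b [bq bx bu]] := pick_in u q u uq.
  apply: (@cross_cycle_path_long x u y p q a b P) => //;
    rewrite ?strictly_under_lev // ?(eq_sym q p) //; try exact: (E_cross _).1.
  - by move=> v /hP[_ vp xv]; rewrite strictly_under_lev.
  - by apply: contra nqp => /hP[].
  - exact: umax ay ax xsy.
  - exact: umax bq bx xq.
  - exact: sP.
move/exists_inPn=> nB.
have anc_out p q : p \in S -> q \in S -> p != q -> (x, p) \notin E -> anc q p.
  move=> pS qS pq nxp; have /exists_inPn/(_ q qS) := nB p pS.
  by rewrite pq nxp negbK.
have S_out : #|S :\: outs E x| <= 1.
  rewrite leqNgt; apply/card_gt1P => -[p [q [/setDP[pS nxp] /setDP[qS nxq] pq]]].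
  rewrite inE in nxp; rewrite inE in nxq.
  have := anc_out p q pS qS pq nxp; have := anc_out q p qS pS _ nxq.
  rewrite eq_sym => /(_ pq) pq' qp; case/eqP: pq; exact: anc_antisym pq' qp.
have : 2 < #|S :&: outs E x|.
  have := cardsID (outs E x) S; have := cardsD1 x (outs E u); have [] := E_deg us.
  have := leq_b1 (x \in outs E u); move: S_out; rewrite -/S.
  by move: (nat_of_bool _) #|S| #|S :&: _| #|S :\: _| #|outs E u|; lia.
case/card_gt2P=> t1 [t2 [t3 [[h1 h2 h3] [n12 n23 n31]]]].
have [w [s' [y [[]]]]] := sort3 lev (P := fun t => t \in S :&: outs E x)
  (R := fun t t' => t != t') (fun _ _ => @neq_sym _ _ _) h1 h2 h3 n12 n23 n31.
have inSx t : t \in S :&: outs E x -> (u, t) \in E /\ (x, t) \in E.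
  by case/setIP=> /inS[ut _]; rewrite inE.
move=> /inSx[uw xw] /inSx[us' xs'] /inSx[uy xy] [ws sy yw lws lsy].
have [a [ay ax au]] := pick_in x y u xy.
have lau := umax a y ay ax (strictly_under_outs xy).
have not_anc v : v != w -> lev w <= lev v -> ~~ anc v w.
  move=> vw le; apply: contra vw => v_w; apply/eqP; exact: anc_eq v_w le.
apply: (@cross_cycle_tree_long x u y s' w a [::]) => //=;
  rewrite ?andbT ?(E_lev xy) ?(E_lev xs') //; try exact: (E_cross _).1; try exact: (E_cross _).2.
- by rewrite eq_sym.
- by apply: not_anc => //; rewrite eq_sym.
- by apply: not_anc => //; apply: leq_trans lsy.
- apply: mod_gap; first exact: leq_ltn_trans lau (E_lev uw).
  by rewrite (E_mod ay).1 (E_mod uw).2.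
Qed.

End Cross.

End Cycles.

(** * A tree with maximal sum of levels *)

Section FinalTree.
Variable D : digraph.

Lemma exists_out_tree (r : D) : (forall v, connect (@darc D) r v) ->
  exists par lev, @out_tree D par lev.
Proof.
move=> conn.
pose walk v n := [exists p : n.-tuple D, path (@darc D) r p && (last r p == v)].
have walkP v n : reflect (exists p, [/\ path (@darc D) r p, last r p = v & size p = n]) (walk v n).
  apply: (iffP existsP) => [[p /andP[rp /eqP lp]]|[p [rp lp sp]]].
    by exists p; rewrite size_tuple.
  by exists (tcast sp (in_tuple p)); rewrite val_tcast rp lp eqxx.
have walk_ex v : exists n, walk v n.
  by have /connectP[p rp ->] := conn v; exists (size p); apply/walkP; exists p.
pose lev v := ex_minn (walk_ex v).
have lev_min v n : walk v n -> lev v <= n.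
  by rewrite /lev; case: ex_minnP => m _; apply.
have lev_walk v : walk v (lev v) by rewrite /lev; case: ex_minnP.
have pred_ex v : 0 < lev v -> exists u, darc u v && (lev v == (lev u).+1).
  have /walkP[p [rp lp sp]] := lev_walk v.
  case/lastP: p rp lp sp => [_ _ <- //|p w].
  rewrite rcons_path last_rcons size_rcons => /andP[rp pw] wv sp _.
  rewrite wv in pw; exists (last r p); rewrite pw /=.
  rewrite eqn_leq; apply/andP; split; last first.
    by rewrite -sp ltnS; apply: lev_min; apply/walkP; exists p.
  have /walkP[q [rq lq sq]] := lev_walk (last r p).
  apply: lev_min; apply/walkP; exists (rcons q v).
  by rewrite rcons_path last_rcons size_rcons rq lq sq.
pose par v := odflt v [pick u | darc u v && (lev v == (lev u).+1)].
exists par, lev; split.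
  have root v : lev v = 0 -> v = r.
    move=> lv0; have /walkP[p [_ lp]] := lev_walk v.
    by rewrite lv0 => /size0nil p0; rewrite -lp p0.
  by move=> v w /root-> /root->.
move=> v /pred_ex[u uv]; rewrite /par; case: pickP => [t /andP[tv /eqP]|/(_ u)] //=.
by rewrite uv.
Qed.

Lemma lev_bound par lev (v : D) : out_tree par lev -> lev v < #|D|.
Proof.
move=> treeT; rewrite -[(lev v).+1]card_ord.
apply: (@leq_card _ _ (fun i : 'I_(lev v).+1 => up par lev v i)) => i j eq_up.
apply: val_inj; rewrite /= -(lev_up treeT (v := v) (n := i)) -1?ltnS // eq_up.
by rewrite (lev_up treeT) // -ltnS.
Qed.

Definition final (par : D -> D) lev : Prop := forall x y : D,
  darc x y -> lev y <= lev x -> anc par lev y x.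

(* Hanging y below x raises the levels of the whole subtree of y. *)
Lemma reattach par lev x y : @out_tree D par lev ->
  darc x y -> lev y <= lev x -> ~~ anc par lev y x ->
  exists par' lev', [/\ @out_tree D par' lev', forall v, lev v <= lev' v & lev y < lev' y].
Proof.
move=> treeT xy lyx nyx.
have y_gt0 : 0 < lev y.
  rewrite lt0n; apply: contra nyx => /eqP ly0.
  rewrite (_ : y = up par lev x 0) ?anc_up //.
  by apply: treeT.1; rewrite ?(lev_up treeT).
pose par' v := if v == y then x else par v.
pose lev' v := if anc par lev y v then lev v + ((lev x).+1 - lev y) else lev v.
exists par', lev'; split.
- split=> [v w|v]; rewrite /lev'.
    by case: ifP => [/anc_lev|_]; case: ifP => [/anc_lev|_]; try lia; exact: treeT.1.
  rewrite /par'; have [->|vy] := eqVneq v y.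
    by rewrite anc_refl (negbTE nyx) => _; split=> //; lia.
  case: ifP => [yv _|nyv v_gt0].
    have v_gt0 : 0 < lev v := leq_trans y_gt0 (anc_lev yv).
    rewrite anc_par // 1?eq_sym //; split; first exact: (darc_par treeT v_gt0).
    by rewrite (lev_par treeT v_gt0).
  split; first exact: (darc_par treeT v_gt0).
  rewrite ifN; first exact: (lev_par treeT v_gt0).
  apply: contraFN nyv => yp; exact: anc_trans yp (par_anc treeT v_gt0).
- by move=> v; rewrite /lev'; case: ifP => // _; exact: leq_addr.
- by rewrite /lev' anc_refl; lia.
Qed.

Lemma exists_final_tree (r : D) : (forall v, connect (@darc D) r v) ->
  exists par lev, @out_tree D par lev /\ final par lev.
Proof.
case/exists_out_tree=> par [lev]; have [n] := ubnP (#|D| * #|D| - \sum_v lev v).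
elim: n par lev => // n IHn par lev le treeT.
case: (boolP [exists x : D, exists y : D,
    [&& darc x y, lev y <= lev x & ~~ anc par lev y x]]); last first.
  move/existsPn=> h; exists par, lev; split=> // x y xy lyx.
  by have /existsPn/(_ y) := h x; rewrite xy lyx negbK.
case/existsP=> x /existsP[y /and3P[xy lyx nyx]].
have [par' [lev' [treeT' le' lt']]] := reattach treeT xy lyx nyx.
apply: (IHn par' lev') => //; rewrite ltnS in le; apply: leq_trans le.
have lt_sum : \sum_v lev v < \sum_v lev' v.
  rewrite (bigD1 y) //= [X in _ < X](bigD1 y) //= -addSn leq_add //.
  exact: leq_sum.
have bound : \sum_v lev' v <= #|D| * #|D|.
  rewrite -sum_nat_const; apply: leq_sum => v _; exact/ltnW/(lev_bound _ treeT').
by move: lt_sum bound; clear; lia.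
Qed.

End FinalTree.
(** * Colouring *)

Lemma colorable_fun (G : sgraph) (C : finType) (f : G -> C) n :
  (forall x y, edge x y -> f x != f y) -> #|C| <= n -> colorable G n.
Proof.
move=> fP le; apply/existsP; exists [ffun x => widen_ord le (enum_rank (f x))].
apply/forallP => x; apply/forallP => y; apply/implyP => xy; rewrite !ffunE.
apply: contra (fP _ _ xy) => /eqP/(congr1 val) /= eq_rank.
by apply/eqP/enum_rank_inj/val_inj.
Qed.

Lemma chromatic_number_le (G : sgraph) n : colorable G n -> chromatic_number G <= n.
Proof. by rewrite /chromatic_number; case: ex_minnP => m _; apply. Qed.

Lemma degenerate_coloring (T : finType) (g : rel T) d :
  symmetric g -> irreflexive g ->
  (forall W : {set T}, W != set0 ->
    exists2 v, v \in W & #|[set w in W | g v w]| <= d) ->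
  exists f : T -> 'I_d.+1, forall v w, g v w -> f v != f w.
Proof.
move=> g_sym g_irr deg.
suff [f fP] : exists f : T -> 'I_d.+1,
    {in [set: T] &, forall v w, g v w -> f v != f w}.
  by exists f => v w; apply: fP; rewrite inE.
have [n] := ubnP #|[set: T]|; elim: n [set: T] => // n IHn W ltW.
have [->|nzW] := eqVneq W set0; first by exists (fun _ => ord0) => v w; rewrite inE.
have [v vW dv] := deg W nzW; rewrite ltnS (cardsD1 v) vW in ltW.
have [f fP] := IHn (W :\ v) ltW.
have [c cP] : exists c, c \notin f @: [set w in W | g v w].
  apply/existsP; rewrite -negb_forall; apply/negP => /forallP h.
  have : #|[set: 'I_d.+1]| <= #|f @: [set w in W | g v w]|.
    by apply/subset_leq_card/subsetP => c _; apply: h.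
  by rewrite cardsT card_ord ltnNge (leq_trans (leq_imset_card _ _) dv).
have c_free w : w \in W -> g v w -> f w != c.
  move=> wW vw; apply: contraNneq cP => <-; apply: imset_f; by rewrite inE wW.
exists (fun w => if w == v then c else f w) => s t sW tW st /=.
have [sv|sv] := eqVneq s v; have [tv|tv] := eqVneq t v.
- by rewrite sv tv g_irr in st.
- by rewrite eq_sym c_free // -sv.
- by rewrite c_free // g_sym -tv.
- by apply: fP; rewrite ?inE ?sv ?tv.
Qed.

Lemma exists_small_degree (T : finType) (g : rel T) (W : {set T}) d :
  W != set0 -> #|[set e in setX W W | g e.1 e.2]| <= d * #|W| ->
  exists2 v, v \in W & #|[set w in W | g v w]| <= d.
Proof.
move=> nzW le; apply/exists_inP; apply: contraLR le => /exists_inPn big.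
rewrite -ltnNge.
have -> : #|[set e in setX W W | g e.1 e.2]| = \sum_(v in W) #|[set w in W | g v w]|.
  under [RHS]eq_bigr do rewrite -sum1_card.
  rewrite pair_big_dep /= -sum1_card; apply: eq_bigl => -[v w].
  by rewrite !inE /= andbA.
have : \sum_(v in W) d.+1 <= \sum_(v in W) #|[set w in W | g v w]|.
  by apply: leq_sum => v /big; rewrite -ltnNge.
apply: leq_trans; rewrite sum_nat_const mulnC ltn_pmul2l ?card_gt0 //.
Qed.

Section Sparse.
Variables (D : digraph) (par : D -> D) (lev : D -> nat) (k : nat).
Hypotheses (treeT : out_tree par lev) (finT : final par lev) (k_gt0 : 0 < k).
Hypothesis noC6 :
  ~ contains_subdivision D (oriented_cycle [:: k; 1; 1; 1; 1; 1]).
Local Notation anc := (anc par lev).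

Definition level_edge : rel D :=
  fun v w => (darc v w || darc w v) && (lev v == lev w %[mod k]).

Lemma sparse_level_edge (W : {set D}) (r : nat) :
  {in W, forall v, lev v %% k = r} ->
  #|[set e in setX W W | level_edge e.1 e.2]| <= 42 * #|W|.
Proof.
move=> Wr.
pose pairs (q : rel D) := [set e in setX W W | (lev e.1 < lev e.2) && q e.1 e.2].
have sparse (q : rel D) :
    (forall E : {set D * D}, E != set0 ->
      (forall v w, (v, w) \in E -> 4 < #|outs E v| /\ 3 < #|ins E w|) ->
      (forall v w, (v, w) \in E -> lev v < lev w) ->
      (forall v w, (v, w) \in E -> lev v %% k = r /\ lev w %% k = r) ->
      (forall v w, (v, w) \in E -> q v w) ->
      contains_subdivision D (oriented_cycle [:: k; 1; 1; 1; 1; 1])) ->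
    #|pairs q| <= 7 * #|W|.
  move=> hq; rewrite leqNgt; apply/negP => big; apply: noC6.
  have sub : pairs q \subset setX W W by apply/subsetP => e; rewrite inE => /andP[].
  have [E [sE nzE dE]] := exists_min_degree (p := 4) (q := 3) sub big.
  have inE' v w : (v, w) \in E -> [/\ v \in W, w \in W, lev v < lev w & q v w].
    by move/(subsetP sE); rewrite !inE => /andP[/andP[? ?] /andP[? ?]].
  apply: (hq E) => // v w /inE'[] // vW wW _ _.
  by rewrite !Wr.
have sF := sparse (fun v w => anc v w && darc v w).
have sB := sparse (fun v w => anc v w && darc w v).
have sX := sparse (fun v w => darc v w && ~~ anc v w).
pose E := pairs (fun v w => anc v w && darc v w) :|:
  pairs (fun v w => anc v w && darc w v) :|:
  pairs (fun v w => darc v w && ~~ anc v w).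
have cE : #|E| <= 21 * #|W|.
  have -> : 21 = 7 + 7 + 7 by [].
  rewrite !mulnDl; apply: leq_trans (leq_card_setU _ _) _; apply: leq_add.
    apply: leq_trans (leq_card_setU _ _) _; apply: leq_add.
      apply: sF => F nzF dF lF mF qF.
      by apply: (ancestors_forward_contains treeT k_gt0 nzF dF lF mF) => v w /qF/andP.
    apply: sB => F nzF dF lF mF qF.
    by apply: (ancestors_backward_contains treeT k_gt0 nzF dF lF mF) => v w /qF/andP.
  apply: sX => F nzF dF lF mF qF.
  by apply: (cross_contains treeT k_gt0 nzF dF lF mF) => v w /qF/andP.
have inE' v w : v \in W -> w \in W -> lev v < lev w -> darc v w || darc w v -> (v, w) \in E.
  move=> vW wW lt vw; rewrite !inE /= vW wW lt /=.
  have [vw'|nvw] := boolP (darc v w); first by rewrite ?andbT; case: (anc v w).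
  have wv : darc w v by rewrite (negbTE nvw) in vw.
  by rewrite wv (finT wv (ltnW lt)).
have sub : [set e in setX W W | level_edge e.1 e.2] \subset
    E :|: [set (e.2, e.1) | e in E].
  apply/subsetP => -[v w]; rewrite inE => /andP[/setXP[/= vW wW] /andP[vw _]].
  rewrite inE; case: (ltngtP (lev v) (lev w)) => [lt|gt|eq].
  - by rewrite inE'.
  - apply/orP; right; apply/imsetP; exists (w, v) => //.
    by rewrite inE' // orbC.
  - have vw_eq : v = w.
      case/orP: vw => [vw|wv].
        by apply/esym; apply: (anc_eq (finT vw _)); rewrite eq.
      by apply: (anc_eq (finT wv _)); rewrite eq.
    by move: vw; rewrite vw_eq darc_irrefl.
apply: leq_trans (subset_leq_card sub) _.
apply: leq_trans (leq_card_setU _ _) _.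
rewrite (_ : 42 = 21 + 21) // mulnDl leq_add //.
exact: leq_trans (leq_imset_card _ _) cE.
Qed.

Lemma level_edge_coloring : exists f : D -> 'I_43,
  forall v w, level_edge v w -> f v != f w.
Proof.
apply: degenerate_coloring => [v w|v|W /set0Pn[v0 v0W]].
- by rewrite /level_edge orbC eq_sym.
- by rewrite /level_edge darc_irrefl.
pose r := lev v0 %% k; pose W' := [set v in W | lev v %% k == r].
have nzW' : W' != set0 by apply/set0Pn; exists v0; rewrite inE v0W eqxx.
have W'r : {in W', forall v, lev v %% k = r} by move=> v; rewrite inE => /andP[_ /eqP].
have [v vW' dv] := exists_small_degree nzW' (sparse_level_edge W'r).
exists v; first by move: vW'; rewrite inE => /andP[].
apply: leq_trans dv; apply/subset_leq_card/subsetP => w; rewrite !inE.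
case/andP=> wW vw; rewrite wW vw andbT /=; case/andP: vw => _ /eqP <-.
by rewrite W'r.
Qed.

End Sparse.

Theorem theorem7 (k : nat) (D : digraph) :
  0 < k ->
  strongly_connected D ->
  ~ contains_subdivision D (oriented_cycle [:: k; 1; 1; 1; 1; 1]) ->
  chi D <= 7 * 24 ^ 2 * k.
Proof.
move=> k_gt0 sc noC6; rewrite (leq_trans _ (_ : 43 * k <= _)) ?leq_mul2r ?orbT //.
apply: chromatic_number_le.
have [r _|D0] := pickP (@predT D); last first.
  apply: (@colorable_fun (underlying D) D id) => [x|]; first by have := D0 x.
  by rewrite eq_card0.
have [par [lev [treeT finT]]] := exists_final_tree (sc r).
have [f fP] := level_edge_coloring treeT finT k_gt0 noC6.
pose C v : 'I_43 * 'I_k := (f v, Ordinal (ltn_pmod (lev v) k_gt0)).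
apply: (@colorable_fun (underlying D) _ C) => [v w vw|]; last by rewrite card_prod !card_ord.
apply/eqP => -[fvw lvw]; have : f v != f w.
  by apply: fP; rewrite /level_edge lvw eqxx andbT.
by rewrite fvw eqxx.
Qed.
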